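(* Let $N\ge1$, $\beta>0$, let $W$ be a real symmetric $N\times N$ matrix and $h\in\mathbb{R}^N$, and let $\nu_{\beta,h}$ be the probability measure on $\{-1,1\}^N$ given by $$\nu_{\beta,h}(x)=\frac{1}{\tilde Z_{\beta,h}}e^{-\frac{\beta}{2}\langle x,Wx\rangle+\langle x,h\rangle},\qquad x\in\{-1,1\}^N.$$ Assume that $$|h|\ge 2\beta\sup_{i\in[N]}\sum_{k\ne i}|W_{ik}|.$$ Then for every $f:\{-1,1\}^N\to\mathbb{R}$, $$\mathrm{Var}_{\nu_{\beta,h}}(f)\le\frac{1}{1-\frac{|h|}{e^{\frac{3|h|}{4}}+e^{-\frac{3|h|}{4}}}}\,\mathcal{E}_{\mathrm{GD}}(f,f).$$
   Context: $[N]=\{1,\dots,N\}$, $\langle\cdot,\cdot\rangle$ is the standard inner product, and $\tilde Z_{\beta,h}$ is the normalizing constant. For $h\in\mathbb{R}^N$, $|h|:=\min_{i\in[N]}|h_i|$ (which is the absolute value of the field when the external field is uniform). Let $X\sim\nu_{\beta,h}$ and let $X_{\sim i}$ denote $X$ with the $i$-th coordinate removed. The Dirichlet form of Glauber dynamics (each site $i$ is resampled from its conditional law given the other coordinates) is $$\mathcal{E}_{\mathrm{GD}}(f,f)=\mathbb{E}_{\nu_{\beta,h}}\sum_{i\in[N]}\left(\mathbb{E}_{\nu_{\beta,h}}[f(X)\mid X_{\sim i}]-f(X)\right)^2 .$$ *)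

(* Defs.v *)
From HB Require Import structures.
From mathcomp Require Import all_boot all_order all_algebra.
From mathcomp Require Import boolp classical_sets reals sequences exp.

Set Implicit Arguments.
Unset Strict Implicit.
Unset Printing Implicit Defensive.

Import Order.TTheory GRing.Theory Num.Theory.
Local Open Scope classical_set_scope.
Local Open Scope ring_scope.

(* The hypercube {-1,1}^N is encoded as {ffun 'I_N -> bool}, with true standing
   for +1 and false for -1; spin_vec is the corresponding vector of R^N. *)
Notation config N := {ffun 'I_N -> bool}.

Definition spin (R : realType) (b : bool) : R := if b then 1 else -1.

Definition spin_vec (R : realType) (N : nat) (x : config N) : 'cV[R]_N :=
  \col_i spin R (x i).

Definition inner (R : realType) (N : nat) (u v : 'cV[R]_N) : R :=
  \sum_i u i 0 * v i 0.

(* The infimum of a finite nonempty family is its minimum; for N = 0 the value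
   is the default 0. *)
Definition min_abs (R : realType) (N : nat) (h : 'cV[R]_N) : R :=
  inf (range (fun i : 'I_N => `|h i 0|)).

Definition gibbs_weight (R : realType) (N : nat) (beta : R) (W : 'M[R]_N)
    (h : 'cV[R]_N) (x : config N) : R :=
  let X := spin_vec R x in
  expR (- (beta / 2) * inner X (W *m X) + inner X h).

Definition partition_function (R : realType) (N : nat) (beta : R)
    (W : 'M[R]_N) (h : 'cV[R]_N) : R :=
  \sum_(x : config N) gibbs_weight beta W h x.

Definition gibbs (R : realType) (N : nat) (beta : R) (W : 'M[R]_N)
    (h : 'cV[R]_N) (x : config N) : R :=
  gibbs_weight beta W h x / partition_function beta W h.

(* Below, nu : config N -> R is the mass function of a probability measure. *)
Definition expect (R : realType) (N : nat) (nu f : config N -> R) : R :=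
  \sum_x nu x * f x.

Definition variance (R : realType) (N : nat) (nu f : config N -> R) : R :=
  expect nu (fun x => (f x - expect nu f) ^+ 2).

Definition agree_off (N : nat) (i : 'I_N) (x y : config N) : bool :=
  [forall j, (j != i) ==> (y j == x j)].

(* E[f(X) | X_{~i} = x_{~i}], as a function of x; elementary conditioning on an
   event which has positive mass when nu > 0, as is the case for gibbs. *)
Definition cond_expect (R : realType) (N : nat) (nu : config N -> R)
    (i : 'I_N) (f : config N -> R) (x : config N) : R :=
  (\sum_(y | agree_off i x y) nu y * f y) / (\sum_(y | agree_off i x y) nu y).

Definition glauber_dirichlet (R : realType) (N : nat) (nu : config N -> R)
    (f : config N -> R) : R :=
  expect nu (fun x => \sum_(i < N) (cond_expect nu i f x - f x) ^+ 2).

(* Main.v *)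
Require Import Defs.
From mathcomp Require Import all_boot all_order all_algebra.
From mathcomp Require Import boolp classical_sets reals sequences exp.
From mathcomp Require Import functions topology normedtype derive realfun.
From mathcomp Require Import ring lra.
Import Order.TTheory GRing.Theory Num.Theory.
Import numFieldNormedType.Exports.
Local Open Scope classical_set_scope.
Local Open Scope ring_scope.

(** Let [A] be the sum over the sites of the heat-bath (conditional
    expectation) operators [P_j].  They are self-adjoint idempotents in
    [L^2(nu)], so the Dirichlet form of [f] is
    [N <f, f> - <f, A f>], and the theorem follows from
    [<f, A f> <= r <f, f>] for centred [f], with [r = N - 1 + rho] and
    [rho = |h| / (e^{3|h|/4} + e^{-3|h|/4})].  Since the norms
    [||A^n f||^2] form a log-convex sequence, it is enough that the
    oscillation of [A^n f] be [O(r^n)] ([poincare_of_oscillation]): any norm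
    in which [A] contracts discrete gradients at rate [r] will do.

    Write [m = |h| / 2], so that every row of [t_ij = beta |W_ij|] sums to at
    most [m], and every local field has absolute value at least [m].
    Flipping spin [i] changes the conditional law of spin [k] by about
    [t_ik sech^2 g_k], where [g_k] is the local field at [k].  Dobrushin's
    argument in the sup norm therefore yields the rate [m sech^2 m].  This is
    at most [rho = m sech (3m/2)] when [m >= 1] ([sech2_le_sech]), but slightly
    larger for small [m].

    The loss is recovered by a sup norm with weights that depend on the
    configuration ([weight]).  The worst rate occurs only where the spins
    around the affected sites all push against the external field; from such a
    configuration the dynamics moves away, because an update replaces a spin on
    average by its conditional mean [tanh g_k], which is smaller than 1 in
    absolute value.  The weight of site [i] is
    [1 - eps * sum_k t_ik |g_k|] (with [|h_k|] capped), hence affine in the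
    configuration: the effect of one heat-bath update on it is explicit, with
    no discretization error even for strong individual couplings.
    [grad_heat_bath] is the exact commutation of gradients with [P_j],
    symmetrized over the value of the differentiated spin so that the drift of
    the weight and the influence term involve the same averages.
    After summation the required bound splits over the neighbours
    ([site_contraction]) and becomes a one-site inequality in real variables
    ([site_inequality]).  At the worst configuration this inequality
    follows from
    [sech^2 m - sech (3m/2) <= m tanh m (1 - tanh m)^2 / 4]
    ([sech2_sub_sech]), and elsewhere the smaller influence
    pays for the smaller drift. *)

Set Implicit Arguments.
Unset Strict Implicit.
Unset Printing Implicit Defensive.

(** * Hyperbolic functions *)

Definition tanhR (R : realType) (v : R) : R :=
  (expR (2 * v) - 1) / (expR (2 * v) + 1).

Definition sech (R : realType) (v : R) : R := 2 / (expR v + expR (- v)).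

Section Tanh.
Variable R : realType.
Implicit Types (u v w m : R).
Local Notation th := (@tanhR R).

Lemma expR_add1_neq0 v : expR v + 1 != 0.
Proof. by rewrite gt_eqF// addr_gt0 ?expR_gt0. Qed.

Lemma tanhR0 : th 0 = 0.
Proof. by rewrite /tanhR mulr0 expR0 subrr mul0r. Qed.

Lemma tanhRN v : th (- v) = - th v.
Proof.
rewrite /tanhR mulrN expRN; have := expR_gt0 (2 * v); set E := expR _ => E0.
by field; rewrite !gt_eqF//; lra.
Qed.

Lemma tanhR_lt1 v : th v < 1.
Proof.
rewrite /tanhR ltr_pdivrMr; have := expR_gt0 (2 * v); lra.
Qed.

Lemma tanhR_gtN1 v : -1 < th v.
Proof. by rewrite ltrNl -tanhRN tanhR_lt1. Qed.

Lemma tanhR_ge0 v : 0 <= v -> 0 <= th v.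
Proof.
move=> v0; rewrite /tanhR divr_ge0//; last by have := expR_gt0 (2 * v); lra.
by have := expR_ge1Dx (2 * v); lra.
Qed.

Lemma tanhR_sub u v : th u - th v = th (u - v) * (1 - th u * th v).
Proof.
rewrite /tanhR (_ : expR (2 * (u - v)) = expR (2 * u) / expR (2 * v)); last first.
  by rewrite -expRB mulrBr.
have := expR_gt0 (2 * u); have := expR_gt0 (2 * v).
set E := expR (2 * u); set F := expR (2 * v) => F0 E0.
by field; rewrite !gt_eqF//; lra.
Qed.

Lemma tanhR_mul_lt1 u v : 0 < 1 - th u * th v.
Proof.
have := tanhR_lt1 u; have := tanhR_lt1 v.
have := tanhR_gtN1 u; have := tanhR_gtN1 v; nra.
Qed.

Lemma tanhR_le u v : u <= v -> th u <= th v.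
Proof.
move=> uv; rewrite -subr_ge0 tanhR_sub mulr_ge0 ?(ltW (tanhR_mul_lt1 _ _))//.
by rewrite tanhR_ge0 ?subr_ge0.
Qed.

Lemma is_derive_tanhR v : is_derive v 1 th (1 - th v ^+ 2).
Proof.
have -> : th = cst 1 - (2 \*: (fun x : R => (expR (2 * x) + 1)^-1)).
  apply/funext => x /=; rewrite /tanhR.
  change ((expR (2 * x) - 1) / (expR (2 * x) + 1) =
          1 - 2 * (expR (2 * x) + 1)^-1).
  by field; exact: expR_add1_neq0.
have E0 := expR_add1_neq0 (2 * v).
have dE : is_derive v 1 (fun x : R => expR (2 * x)) (expR (2 * v) * 2).
  apply: (@is_derive1_comp _ expR (fun x => 2 * x)).
  by apply: is_derive_eq (is_deriveZ 2 (is_derive_id v 1)) _; exact: mulr1.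
have dE1 : is_derive v 1 (fun x : R => expR (2 * x) + 1) (expR (2 * v) * 2).
  by apply: is_derive_eq (addr0 _); exact: is_deriveD.
have dV : is_derive v 1 (fun x : R => (expR (2 * x) + 1)^-1)
    (- (expR (2 * v) + 1) ^- 2 *: (expR (2 * v) * 2)).
  apply: DeriveDef; first by apply: derivableV => //; exact: ex_derive.
  by rewrite deriveV//; congr (_ *: _); exact: derive_val.
apply: (is_derive_eq (is_deriveB (is_derive_cst _ _ _) (is_deriveZ 2 dV))).
change (0 - 2 * (- (expR (2 * v) + 1) ^- 2 * (expR (2 * v) * 2)) =
        1 - (1 - 2 * (expR (2 * v) + 1)^-1) ^+ 2).
by field.
Qed.

(** The mean value theorem for [tanh] bounds it from above by the identity and
    from below by [v sech^2 v]. *)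
Lemma tanhR_secant v : 0 <= v ->
  exists2 c, 0 <= c <= v & th v = (1 - th c ^+ 2) * v.
Proof.
move=> v0.
have [||c] := @MVT_segment R th (fun x => 1 - th x ^+ 2) 0 v v0.
- by move=> x _; exact: is_derive_tanhR.
- apply: continuous_subspaceT => x.
  apply: differentiable_continuous; apply/derivable1_diffP.
  exact: (@ex_derive _ _ _ _ _ _ _ (is_derive_tanhR x)).
rewrite in_itv/= => cv; rewrite tanhR0 !subr0 => E.
by exists c.
Qed.

Lemma tanhR_le_id v : 0 <= v -> th v <= v.
Proof.
move=> v0; have [c _ ->] := tanhR_secant v0.
by have := sqr_ge0 (th c); nra.
Qed.

Lemma sech2_mul_le_tanhR v : 0 <= v -> v * (1 - th v ^+ 2) <= th v.
Proof.
move=> v0; have [c /andP[c0 cv] E] := tanhR_secant v0.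
rewrite [leRHS]E mulrC ler_wpM2r// lerB// lerXn2r ?nnegrE ?tanhR_ge0//.
exact: tanhR_le.
Qed.

(** Concavity of [tanh] on the half-line, obtained from the addition formula
    [tanhR_sub] and [tanh v <= v]. *)
Lemma tanhR_le_tangent m v : 0 <= m -> m <= v ->
  th v <= th m + (1 - th m ^+ 2) * (v - m).
Proof.
move=> m0 mv; rewrite -lerBlDl tanhR_sub mulrC.
have h1 := tanhR_mul_lt1 v m; have h2 := tanhR_le mv.
have h3 := tanhR_ge0 m0.
have vm : 0 <= v - m by rewrite subr_ge0.
have h4 := tanhR_le_id vm; have h5 := tanhR_ge0 vm.
apply: ler_pM => //; first exact: ltW.
by rewrite expr2; nra.
Qed.

Lemma tanhR_add_ge m v : 0 <= m -> 0 <= v ->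
  th m + (1 - th m) * th v <= th (m + v).
Proof.
move=> m0 v0; have E := tanhR_sub (v + m) m; rewrite addrK in E.
rewrite [m + v]addrC.
have h1 := tanhR_lt1 (v + m); have h3 := tanhR_ge0 m0.
have h5 := tanhR_ge0 v0.
suff : 0 <= th v * (th m * (1 - th (v + m))) by nra.
apply: mulr_ge0 => //; apply: mulr_ge0 => //; lra.
Qed.

Lemma tanhR_ge_frac v : 0 <= v -> v / (1 + v) <= th v.
Proof.
move=> v0; rewrite /tanhR ler_pdivrMr; last lra.
rewrite mulrAC ler_pdivlMr; last by have := expR_gt0 (2 * v); lra.
by have := expR_ge1Dx (2 * v); nra.
Qed.

Lemma tanhR1_ge : 2 / 3 <= th 1.
Proof.
rewrite /tanhR mulr1 ler_pdivlMr; last by have := expR_gt0 (2 : R); lra.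
suff : 5 <= expR (2 : R) by lra.
have -> : (2 : R) = 4%:R * (1 / 2) by lra.
rewrite expRM_natl; apply: (@le_trans _ _ ((1 + 1 / 2) ^+ 4)); first by lra.
by rewrite lerXn2r ?expR_ge1Dx// nnegrE ?expR_ge0//; lra.
Qed.

Lemma sech_gt0 v : 0 < sech v.
Proof. by rewrite divr_gt0// addr_gt0// expR_gt0. Qed.

End Tanh.

(** * Comparison of [sech^2 m] and [sech (3m/2)] *)

Section ScalarInequality.
Variables (R : realType) (m : R).
Local Notation th := (@tanhR R).
Local Notation t := (th m).
Local Notation q := (sech (3 * m / 2)).

Lemma tanhR_half_expR : t = (expR (m / 2) ^+ 4 - 1) / (expR (m / 2) ^+ 4 + 1).
Proof. by rewrite /tanhR -expRM_natl (_ : 4%:R * (m / 2) = 2 * m)//; lra. Qed.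

Lemma sech_three_halves : q = 2 * expR (m / 2) ^+ 3 / (expR (m / 2) ^+ 6 + 1).
Proof.
rewrite /sech (_ : 3 * m / 2 = 3%:R * (m / 2)); last lra.
rewrite expRN expRM_natl; have := expR_gt0 (m / 2); set y := expR _ => y0.
have y3 : 0 < y ^+ 3 by rewrite exprn_gt0.
have y6 : 0 < y ^+ 6 by rewrite exprn_gt0.
by field; rewrite !gt_eqF//; nra.
Qed.

(** The defect of the unweighted argument, dominated by the drift gained at the
    worst configuration.  Bounding the factor [m] below by [2 tanh (m/2)]
    turns the claim into a polynomial inequality in [y = e^{m/2}] from which
    the factor [(y - 1)^2] splits off. *)
Lemma sech2_sub_sech : 0 <= m ->
  1 - t ^+ 2 - q <= m * (t * (1 - t) ^+ 2 / 4).
Proof.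
move=> m0; have tm : 2 * th (m / 2) <= m.
  have m20 : 0 <= m / 2 by lra.
  by have := tanhR_le_id m20; lra.
have t0 := tanhR_ge0 m0; have t1 := tanhR_lt1 m.
apply: (@le_trans _ _ (2 * th (m / 2) * (t * (1 - t) ^+ 2 / 4))); last first.
  by apply: ler_wpM2r => //; rewrite divr_ge0// mulr_ge0// sqr_ge0.
rewrite sech_three_halves tanhR_half_expR /tanhR expRM_natl.
have : 1 <= expR (m / 2) by have := expR_ge1Dx (m / 2); lra.
set y := expR _ => y1; pose v := y - 1; have v0 : 0 <= v by rewrite /v; lra.
have Ey : y = 1 + v by rewrite /v; lra.
have y20 : 0 < y ^+ 2 by rewrite exprn_gt0//; lra.
have y40 : 0 < y ^+ 4 by rewrite exprn_gt0//; lra.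
have y60 : 0 < y ^+ 6 by rewrite exprn_gt0//; lra.
rewrite -subr_ge0.
have -> : 2 * ((y ^+ 2 - 1) / (y ^+ 2 + 1)) *
    ((y ^+ 4 - 1) / (y ^+ 4 + 1) * (1 - (y ^+ 4 - 1) / (y ^+ 4 + 1)) ^+ 2 / 4) -
    (1 - ((y ^+ 4 - 1) / (y ^+ 4 + 1)) ^+ 2 - 2 * y ^+ 3 / (y ^+ 6 + 1)) =
    2 * v ^+ 2 *
    ((y + 1) ^+ 2 * (y ^+ 6 + 1) + (y ^+ 4 + 1) * y ^+ 3 *
       (y ^+ 6 - y ^+ 4 - 2 * y ^+ 3 - y ^+ 2 + 1)) /
    ((y ^+ 4 + 1) ^+ 3 * (y ^+ 6 + 1)).
  by rewrite /v; field; rewrite !gt_eqF//; lra.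
apply: divr_ge0; last first.
  by apply: mulr_ge0; [apply: exprn_ge0|]; lra.
apply: mulr_ge0; first by rewrite mulr_ge0// sqr_ge0.
rewrite Ey.
have -> : (1 + v + 1) ^+ 2 * ((1 + v) ^+ 6 + 1) +
  ((1 + v) ^+ 4 + 1) * (1 + v) ^+ 3 *
  ((1 + v) ^+ 6 - (1 + v) ^+ 4 - 2 * (1 + v) ^+ 3 - (1 + v) ^+ 2 + 1) =
  4 - 18 * v ^+ 2 - 22 * v ^+ 3 + 85 * v ^+ 4 + 412 * v ^+ 5 + 875 * v ^+ 6
  + 1156 * v ^+ 7 + 1033 * v ^+ 8 + 640 * v ^+ 9 + 273 * v ^+ 10
  + 77 * v ^+ 11 + 13 * v ^+ 12 + v ^+ 13 by ring.
have vn n : 0 <= v ^+ n by exact: exprn_ge0.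
(* Only the quartic part has negative coefficients. *)
have h4 : 0 <= 4 - 18 * v ^+ 2 - 22 * v ^+ 3 + 85 * v ^+ 4.
  by have := sqr_ge0 (2 - 11 / 2 * v ^+ 2); have := sqr_ge0 (v * (11 - 40 * v)); nra.
have := vn 5%N; have := vn 6%N; have := vn 7%N; have := vn 8%N.
have := vn 9%N; have := vn 10%N; have := vn 11%N; have := vn 12%N.
have := vn 13%N; lra.
Qed.

(** In terms of [z = e^{3m/4}], this combines [sinh v >= v] with
    [cosh (2v) = 1 + 2 sinh^2 v]. *)
Lemma mul_sech_le_half : 0 <= m -> m * q <= 1 / 2.
Proof.
move=> m0.
have z0 := expR_gt0 (3 * m / 4); set z := expR _ in z0.
have zi : z * z^-1 = 1 by rewrite divff// gt_eqF.
have -> : q = 2 / (z ^+ 2 + z^-1 ^+ 2).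
  by rewrite /sech -expRN -!expRM_natl; do 3 f_equal; f_equal; lra.
have zi0 : 0 < z^-1 by rewrite invr_gt0.
have v0 : 0 <= 3 * m / 8 by lra.
have : 3 * m / 2 <= z - z^-1.
  have := sech2_mul_le_tanhR v0; rewrite /tanhR.
  rewrite (_ : 2 * (3 * m / 8) = 3 * m / 4) -/z; last lra.
  rewrite -subr_ge0.
  have -> : (z - 1) / (z + 1) - 3 * m / 8 * (1 - ((z - 1) / (z + 1)) ^+ 2) =
     (z - z^-1 - 3 * m / 2) * (z / (z + 1) ^+ 2).
    by field; rewrite !gt_eqF//; lra.
  rewrite pmulr_lge0 ?subr_ge0// divr_gt0// exprn_gt0//; lra.
move=> h; rewrite mulrA ler_pdivrMr; last by nra.
have : (3 * m / 2) ^+ 2 <= (z - z^-1) ^+ 2.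
  by rewrite lerXn2r// nnegrE; lra.
have -> : (z - z^-1) ^+ 2 = z ^+ 2 + z^-1 ^+ 2 - 2 by rewrite sqrrB zi; ring.
have := sqr_ge0 (3 * m / 2 - 4 / 3); nra.
Qed.

End ScalarInequality.

(** * The one-site inequality *)

Section Site.
Variable R : realType.
Implicit Types m b u Y G : R.
Local Notation th := (@tanhR R).

(** The slope of the weights.  It is tied to [tanh m (1 - tanh m)] because,
    up to a constant, the influence decreases at least at that rate as the local
    field moves away from its minimum [m]; for [m >= 1] constant
    weights suffice. *)
Definition tilt m : R := if m <= 1 then th m * (1 - th m) / 4 else 0.

Lemma tilt_ge0 m : 0 <= m -> 0 <= tilt m.
Proof.
move=> m0; rewrite /tilt; case: ifP => // _.
have := tanhR_ge0 m0; have := tanhR_lt1 m => h1 h2.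
by rewrite divr_ge0// mulr_ge0//; lra.
Qed.

Lemma tilt_le m : 0 <= m -> tilt m * (m * (3 * m + 1)) <= 1 / 4.
Proof.
move=> m0; rewrite /tilt; case: ifP => [m1|_]; last by rewrite mul0r; lra.
have h1 : th m * (1 - th m) / 4 <= 1 / 16.
  by have := sqr_ge0 (th m - 1 / 2); nra.
have h2 : 0 <= m * (3 * m + 1) <= 4 by nra.
by nra.
Qed.

(** The lower bound [y = e^{m/2} >= 8/5], which [m >= 1] provides, is what makes
    the remaining factor of the difference positive. *)
Lemma sech2_le_sech m : 1 <= m -> 1 - th m ^+ 2 <= sech (3 * m / 2).
Proof.
move=> m1; rewrite sech_three_halves tanhR_half_expR.
have : 8 / 5 <= expR (m / 2).
  rewrite (_ : m / 2 = 4%:R * (m / 8)); last lra.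
  rewrite expRM_natl; apply: (@le_trans _ _ ((9 / 8) ^+ 4)); first by lra.
  have := expR_ge1Dx (m / 8) => h.
  by rewrite lerXn2r ?nnegrE ?expR_ge0//; lra.
set y := expR _ => y1.
have y4 : 0 < y ^+ 4 by rewrite exprn_gt0//; lra.
have y6 : 0 < y ^+ 6 by rewrite exprn_gt0//; lra.
have y3 : 0 < y ^+ 3 by rewrite exprn_gt0//; lra.
rewrite -subr_ge0.
have -> : 2 * y ^+ 3 / (y ^+ 6 + 1) - (1 - ((y ^+ 4 - 1) / (y ^+ 4 + 1)) ^+ 2)
  = 2 * y ^+ 3 * (y - 1) ^+ 2 * (y ^+ 6 - y ^+ 4 - 2 * y ^+ 3 - y ^+ 2 + 1) /
    ((y ^+ 6 + 1) * (y ^+ 4 + 1) ^+ 2).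
  by field; rewrite !gt_eqF//; lra.
apply: divr_ge0; last by apply: mulr_ge0; [|apply: sqr_ge0]; lra.
apply: mulr_ge0; first by apply: mulr_ge0; [lra|exact: sqr_ge0].
pose v := y - 8 / 5; have v0 : 0 <= v by rewrite /v; lra.
have -> : y = 8 / 5 + v by rewrite /v; lra.
have vn n : 0 <= v ^+ n by exact: exprn_ge0.
have := vn 2%N; have := vn 3%N; have := vn 4%N; have := vn 5%N.
have := vn 6%N; lra.
Qed.

(** Here [b] and [b + 2 * u] are the absolute values of the local field at the
    site for the two values of the spin with coupling [u], so that [d] bounds
    the influence per unit of coupling; [Y] is the total push of the other spins
    against the external field and [G] the capped local field.  If
    [x = b - m] and [u] vanish, then [Y >= m] and the drift beats the defect
    [sech2_sub_sech]; for [x < 1] the drift loses at most a linear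
    function of [x] and [u], and the gain [s - d] is at least such a function.
    For [x >= 1] the gain is a constant
    multiple of the slope, and crude bounds on [Y] and [G] are enough. *)
Lemma site_inequality m b u Y G s d :
  s = 1 - th m ^+ 2 -> d = 1 - th b * th (b + 2 * u) ->
  0 <= m -> m <= b -> 0 <= u <= m ->
  2 * m - b - u <= Y -> - m <= Y -> G <= b + 2 * u -> G <= 3 * m + 1 ->
  s - 3 / 4 * (s - d) - tilt m * Y + tilt m * (m * (th m - s * m)) <=
  sech (3 * m / 2) - tilt m * (m * sech (3 * m / 2)) * G.
Proof.
move=> sE dE m0 mb /andP[u0 um] Y1 Y2 G1 G2.
have tb : th m <= th b by exact: tanhR_le.
have tbu : th b <= th (b + 2 * u) by apply: tanhR_le; lra.
have t0 := tanhR_ge0 m0; have t1 := tanhR_lt1 m.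
have sd0 : 0 <= s - d by rewrite sE dE; nra.
have [m1|m1] := lerP m 1; last first.
  rewrite /tilt (lt_geF m1) !mul0r !subr0 addr0.
  by have := sech2_le_sech (ltW m1); rewrite -sE; lra.
have mq := mul_sech_le_half m0.
have q0 : 0 < sech (3 * m / 2) by exact: sech_gt0.
have key := sech2_sub_sech m0; rewrite -sE in key.
set q := sech _ in mq q0 key *.
have e0 := tilt_ge0 m0.
have eE : th m * (1 - th m) = 4 * tilt m by rewrite /tilt m1; lra.
set e := tilt m in e0 eE *.
have {}key : s - q <= e * (m * (1 - th m)).
  by apply: le_trans key _; rewrite le_eqVlt; apply/orP; left; apply/eqP; nra.
have sd : th m * ((th b - th m) + (th (b + 2 * u) - th m)) <= s - d.
  by rewrite sE dE; nra.
have s01 : 0 <= s <= 1 by rewrite sE; nra.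
pose x := b - m; have x0 : 0 <= x by rewrite /x; lra.
have h1 : (1 - th m) * th x <= th b - th m.
  by have := tanhR_add_ge m0 x0; rewrite [m + x]addrC subrK; lra.
have [x1|x1] := lerP 1 x.
  have h2 : 2 / 3 <= th x by apply: le_trans (tanhR1_ge R) _; exact: tanhR_le.
  have p1 : 2 / 3 * (1 - th m) <= th b - th m.
    by apply: le_trans h1; rewrite mulrC ler_wpM2l//; lra.
  have h3 : 16 / 3 * e <= s - d.
    apply: le_trans sd; apply: (@le_trans _ _ (th m * (4 / 3 * (1 - th m)))).
      lra.
    by rewrite ler_wpM2l//; lra.
  have mq0 : 0 <= m * q by rewrite mulr_ge0// ltW.
  have h4 : m * q * G <= 1 / 2 * (3 * m + 1).
    apply: (@le_trans _ _ (m * q * (3 * m + 1))); first by rewrite ler_wpM2l.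
    by rewrite ler_wpM2r//; lra.
  have h5 : e * (m * q * G) <= e * (1 / 2 * (3 * m + 1)) by rewrite ler_wpM2l.
  have h6 : e * - m <= e * Y by rewrite ler_wpM2l.
  have h7 : e * (m * (1 - th m) + m + m * th m + 1 / 2 * (3 * m + 1)) <= e * 4.
    rewrite ler_wpM2l//; nra.
  have h8 : 0 <= e * (s * m ^+ 2) by rewrite mulr_ge0// mulr_ge0 ?sqr_ge0//; lra.
  lra.
have h2 : (1 - th m) * th (2 * u) <= th (b + 2 * u) - th m.
  have u20 : 0 <= 2 * u by lra.
  have := tanhR_add_ge m0 u20.
  have : th (m + 2 * u) <= th (b + 2 * u) by apply: tanhR_le; lra.
  lra.
have h3 : x / 2 <= th x.
  apply: le_trans (tanhR_ge_frac x0); rewrite ler_wpM2l// lef_pV2 ?posrE; lra.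
have h4 : 2 * u / 3 <= th (2 * u).
  have u20 : 0 <= 2 * u by lra.
  by apply: le_trans (tanhR_ge_frac u20); rewrite ler_wpM2l// lef_pV2 ?posrE; lra.
have h5 : 4 * e * (x / 2 + 2 * u / 3) <= s - d.
  apply: le_trans sd; rewrite -eE -mulrA; apply: ler_wpM2l => //.
  rewrite mulrDr; apply: lerD; [apply: le_trans h1|apply: le_trans h2].
    by rewrite ler_wpM2l//; lra.
  by rewrite ler_wpM2l//; lra.
have h6 : m * q * G <= m * q * m + 1 / 2 * (x + 2 * u).
  have : m * q * G <= m * q * (m + (x + 2 * u)).
    by rewrite ler_wpM2l//; [nra|rewrite /x; lra].
  have : 0 <= x + 2 * u by lra.
  nra.
have h7 : e * (m * q * G) <= e * (m * q * m + 1 / 2 * (x + 2 * u)).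
  by rewrite ler_wpM2l.
have h8 : e * (m - x - u) <= e * Y by rewrite ler_wpM2l// /x; lra.
have em : 0 <= e * m ^+ 2 <= 1.
  have := tilt_le m0; rewrite -/e => em1.
  apply/andP; split; first by rewrite mulr_ge0// sqr_ge0.
  have : 0 <= e * (m ^+ 2 + m) by rewrite mulr_ge0//; nra.
  nra.
have h9 : (s - q) * (1 - e * m ^+ 2) <= e * (m * (1 - th m)).
  have : 0 <= e * (m * (1 - th m)) by rewrite !mulr_ge0//; lra.
  by case: (lerP 0 (s - q)) => h; nra.
have h10 : 0 <= e * (x / 2 + 2 * u / 3) by rewrite mulr_ge0//; lra.
lra.
Qed.

End Site.

(** * Heat-bath updates and discrete gradients *)

Section Update.
Variables (N : nat).
Implicit Types (x : config N) (i j : 'I_N) (b c : bool).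

Definition upd x i b : config N := [ffun k => if k == i then b else x k].

Lemma updE x i b k : upd x i b k = if k == i then b else x k.
Proof. by rewrite ffunE. Qed.

Lemma upd_id x i : upd x i (x i) = x.
Proof. by apply/ffunP => k; rewrite updE; case: eqP => [->|]. Qed.

Lemma upd_upd x i b c : upd (upd x i b) i c = upd x i c.
Proof. by apply/ffunP => k; rewrite !updE; case: eqP. Qed.

Lemma upd_comm x i j b c : i != j ->
  upd (upd x i b) j c = upd (upd x j c) i b.
Proof.
move=> ij; apply/ffunP => k; rewrite !updE.
by have [->|] := eqVneq k i; rewrite ?(negbTE ij).
Qed.

End Update.

Section HeatBath.
Variables (R : realType) (N : nat) (h : 'I_N -> R) (tau : 'I_N -> 'I_N -> R).
Implicit Types (x : config N) (i j k : 'I_N) (b : bool) (f : config N -> R).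
Local Notation th := (@tanhR R).
Local Notation sp := (spin R).

Definition local_field j x : R := h j - \sum_k tau j k * sp (x k).

Definition heat_bath j f x : R :=
  (1 + th (local_field j x)) / 2 * f (upd x j true) +
  (1 - th (local_field j x)) / 2 * f (upd x j false).

Definition grad i f x : R := f (upd x i true) - f (upd x i false).

(** Gradients in direction [i] see spin [j] through its mean magnetization,
    averaged over the two values of spin [i], and through its dependence on
    spin [i]. *)
Definition mean_mag i j x : R :=
  (th (local_field j (upd x i true)) + th (local_field j (upd x i false))) / 2.

Definition jump i j x : R :=
  th (local_field j (upd x i true)) - th (local_field j (upd x i false)).

Lemma sum_upd (a : 'I_N -> R) x i b :
  \sum_k a k * sp (upd x i b k) =
  \sum_k a k * sp (x k) + a i * (sp b - sp (x i)).
Proof.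
rewrite (bigD1 i)//= [in RHS](bigD1 i)//= updE eqxx.
rewrite (eq_bigr (fun k => a k * sp (x k))); first by ring.
by move=> k ki; rewrite updE (negbTE ki).
Qed.

Lemma local_field_upd i j x b :
  local_field j (upd x i b) = local_field j x - tau j i * (sp b - sp (x i)).
Proof. by rewrite /local_field sum_upd; ring. Qed.

Lemma local_field_upd_self j x b : tau j j = 0 ->
  local_field j (upd x j b) = local_field j x.
Proof. by move=> t0; rewrite local_field_upd t0 mul0r subr0. Qed.

Lemma grad_heat_bath_self i f x : tau i i = 0 -> grad i (heat_bath i f) x = 0.
Proof.
by move=> t0; rewrite /grad /heat_bath !local_field_upd_self// !upd_upd subrr.
Qed.

(** When spin [i] is differentiated, the law of the new spin [j] also changes.
    Either of the two values of spin [i] could be used in the factors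
    [grad j f]; taking their mean makes the averaged weights of
    [site_contraction] match the averages in [mean_mag]. *)
Lemma grad_heat_bath i j f x : i != j ->
  grad i (heat_bath j f) x =
  (1 + mean_mag i j x) / 2 * grad i f (upd x j true) +
  (1 - mean_mag i j x) / 2 * grad i f (upd x j false) +
  jump i j x / 2 *
    ((grad j f (upd x i true) + grad j f (upd x i false)) / 2).
Proof.
move=> ij; rewrite /grad /heat_bath /mean_mag /jump !(upd_comm _ _ _ ij).
by field.
Qed.

End HeatBath.

(** * Contraction of weighted gradients *)

Section Contraction.
Variables (R : realType) (N : nat) (h : 'I_N -> R) (tau : 'I_N -> 'I_N -> R).
Variable m : R.
Implicit Types (x : config N) (i j k : 'I_N) (b : bool) (f : config N -> R).
Local Notation th := (@tanhR R).
Local Notation sp := (spin R).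
Local Notation lf := (local_field h tau).
Local Notation e := (tilt m).
Local Notation q := (sech (3 * m / 2)).

Definition orient j : R := if 0 <= h j then 1 else -1.

(** How strongly the other spins act against the external field at [j]. *)
Definition push j x : R := orient j * \sum_k tau j k * sp (x k).

(** The local field in the direction of [h j].  Sites with a very large
    external field are almost frozen; the cap keeps the weights bounded, and is
    large enough for [norm_tanh_local_field] to survive: beyond it the tangent
    at [m] already exceeds 1. *)
Definition capped_field j x : R := Num.min `|h j| (2 * m + 1) - push j x.

Definition weight i x : R := 1 - e * \sum_k `|tau i k| * capped_field k x.

Lemma orientE j : orient j * h j = `|h j|.
Proof.
rewrite /orient; case: lerP => h0; first by rewrite mul1r ger0_norm.
by rewrite mulN1r ltr0_norm.
Qed.

Lemma norm_orient j : `|orient j| = 1.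
Proof. by rewrite /orient; case: ifP; rewrite ?normrN normr1. Qed.

Lemma norm_spin b : `|sp b| = 1.
Proof. by rewrite /spin; case: b; rewrite ?normrN normr1. Qed.

Lemma orient_local_field j x : orient j * lf j x = `|h j| - push j x.
Proof. by rewrite /local_field mulrBr orientE. Qed.

Lemma norm_tanhR v : `|th v| = th `|v|.
Proof.
wlog v0 : v / 0 <= v => [hw|]; last by rewrite !ger0_norm ?tanhR_ge0.
case: (lerP 0 v) => [/hw//|v0].
by rewrite -normrN -tanhRN hw ?normrN// oppr_ge0 ltW.
Qed.

Lemma push_upd i j x b :
  push j (upd x i b) = push j x + orient j * tau j i * (sp b - sp (x i)).
Proof. by rewrite /push sum_upd; ring. Qed.

(** The weights are affine in each spin, so that averaging over an update of
    mean [a] replaces the spin by [a]. *)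
Lemma weight_mix i j x (a : R) :
  (1 + a) / 2 * weight i (upd x j true) +
  (1 - a) / 2 * weight i (upd x j false) =
  weight i x +
  e * \sum_k `|tau i k| * (orient k * tau k j * (a - sp (x j))).
Proof.
have E b : weight i (upd x j b) = weight i x +
    e * (\sum_k `|tau i k| * (orient k * tau k j)) * (sp b - sp (x j)).
  rewrite /weight (_ : \sum_k `|tau i k| * capped_field k (upd x j b) =
      \sum_k `|tau i k| * capped_field k x -
      (\sum_k `|tau i k| * (orient k * tau k j)) * (sp b - sp (x j))); first by ring.
  rewrite mulr_suml -sumrB; apply: eq_bigr => k _.
  by rewrite /capped_field push_upd; ring.
rewrite !E (_ : \sum_k `|tau i k| * (orient k * tau k j * (a - sp (x j))) =
  (\sum_k `|tau i k| * (orient k * tau k j)) * (a - sp (x j))); last first.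
  by rewrite mulr_suml; apply: eq_bigr => k _; ring.
by rewrite /spin; field.
Qed.

Section Bounds.
Hypotheses (m_ge0 : 0 <= m) (tau_sym : forall i j, tau i j = tau j i)
  (tau_diag : forall i, tau i i = 0)
  (tau_row : forall i, \sum_k `|tau i k| <= m)
  (h_large : forall i, 2 * m <= `|h i|).

Lemma norm_push j x : `|push j x| <= m.
Proof.
rewrite normrM norm_orient mul1r.
apply: le_trans (ler_norm_sum _ _ _) (le_trans _ (tau_row j)).
by apply: ler_sum => k _; rewrite normrM norm_spin mulr1.
Qed.

Lemma capped_field_bounds j x : m <= capped_field j x <= 3 * m + 1.
Proof.
have := norm_push j x; rewrite ler_norml => /andP[p1 p2].
have := h_large j; have := m_ge0 => m0 hj.
rewrite /capped_field; case: (lerP `|h j| (2 * m + 1)) => h1; apply/andP; split; lra.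
Qed.

(** The tangent line of [tanh] at [m] makes the mean magnetization comparable to
    the same capped field that enters the weights. *)
Lemma norm_tanh_local_field j x :
  `|th (lf j x)| <= th m + (1 - th m ^+ 2) * (capped_field j x - m).
Proof.
have := norm_push j x; rewrite ler_norml => /andP[p1 p2].
have := h_large j; have m0 := m_ge0 => hj.
have t0 := tanhR_ge0 m0; have t1 := tanhR_lt1 m.
have E : `|lf j x| = `|h j| - push j x.
  rewrite -orient_local_field -[LHS]mul1r -(norm_orient j) -normrM.
  by rewrite ger0_norm// orient_local_field; lra.
rewrite norm_tanhR E /capped_field.
case: (lerP `|h j| (2 * m + 1)) => h1.
  by apply: tanhR_le_tangent => //; lra.
apply: (le_trans (ltW (tanhR_lt1 _))).
have : (1 - th m ^+ 2) * 1 <= (1 - th m ^+ 2) * (2 * m + 1 - push j x - m).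
  by rewrite ler_wpM2l//; [nra|lra].
nra.
Qed.

Lemma weight_bounds i x : 3 / 4 <= weight i x <= 1.
Proof.
have m0 := m_ge0; have e0 := tilt_ge0 m0.
have b0 k := andP (capped_field_bounds k x).
have h1 : \sum_k `|tau i k| * capped_field k x <= m * (3 * m + 1).
  apply: (@le_trans _ _ (\sum_k `|tau i k| * (3 * m + 1))).
    by apply: ler_sum => k _; rewrite ler_wpM2l// (b0 k).2.
  by rewrite -mulr_suml ler_wpM2r ?tau_row//; lra.
have h2 : 0 <= \sum_k `|tau i k| * capped_field k x.
  apply: sumr_ge0 => k _; apply: mulr_ge0 => //.
  by apply: le_trans (b0 k).1.
have h3 := tilt_le m0.
have h4 : e * (\sum_k `|tau i k| * capped_field k x) <= e * (m * (3 * m + 1)).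
  by rewrite ler_wpM2l.
have h5 := mulr_ge0 e0 h2.
by rewrite /weight; apply/andP; split; lra.
Qed.

Lemma norm_mean_mag i j x :
  `|mean_mag h tau i j x| <= th m + (1 - th m ^+ 2) *
    ((capped_field j (upd x i true) + capped_field j (upd x i false)) / 2 - m).
Proof.
have := norm_tanh_local_field j (upd x i true).
have := norm_tanh_local_field j (upd x i false).
rewrite !ler_norml /mean_mag => /andP[a1 a2] /andP[b1 b2].
by apply/andP; split; lra.
Qed.

(** The two local fields at [k], for the two values of spin [i], have absolute
    values [b] and [b + 2 |tau k i|]; which one belongs to which value of the
    spin depends on signs. *)
Lemma norm_jump i k x (b := `|h k| - \sum_(j | j != i) orient k * tau k j * sp (x j)
    - `|tau k i|) :
  m <= b ->
  `|jump h tau i k x| = th (b + 2 * `|tau k i|) - th b.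
Proof.
move=> mb.
have m0 := m_ge0.
have E c : orient k * lf k (upd x i c) =
    b + `|tau k i| - orient k * tau k i * sp c.
  rewrite orient_local_field push_upd /push mulr_sumr (bigD1 i)//= /b.
  under eq_bigr do rewrite mulrA.
  by ring.
have J : `|jump h tau i k x| =
    `|th (orient k * lf k (upd x i true)) - th (orient k * lf k (upd x i false))|.
  rewrite /jump /orient; case: ifP => _; first by rewrite !mul1r.
  by rewrite !mulN1r !tanhRN -opprD normrN.
have u0 : 0 <= `|tau k i| by [].
have tn : `|tau k i| = `|orient k * tau k i| by rewrite normrM norm_orient mul1r.
rewrite J !E /spin mulr1 mulrN1 opprK.
have le : th b <= th (b + 2 * `|tau k i|) by apply: tanhR_le; lra.
case: (lerP 0 (orient k * tau k i)) => s0.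
  rewrite tn (ger0_norm s0) in le *.
  rewrite distrC ger0_norm; last first.
    by rewrite subr_ge0; apply: tanhR_le; lra.
  by congr (th _ - th _); lra.
rewrite tn (ltr0_norm s0) in le *.
rewrite ger0_norm; last first.
  by rewrite subr_ge0; apply: tanhR_le; lra.
by congr (th _ - th _); lra.
Qed.

(** The contribution of neighbour [k] to the gradient at [i]: its influence,
    weighted by its own weight, plus the drift that its push induces on the
    weight of [i].  The magnetizations of the sites [j] around [k] enter the
    drift with a plus sign and the weight of [k] with a minus sign; by
    [norm_mean_mag] they nearly cancel, leaving only an error proportional to
    [s - d], a quarter of which is absorbed because [tilt_le] holds. *)
Lemma site_contraction i k x : i != k ->
  `|jump h tau i k x| / 2 *
    ((weight k (upd x i true) + weight k (upd x i false)) / 2) +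
  `|tau i k| * (e * \sum_(j | j != i)
      orient k * tau k j * (mean_mag h tau i j x - sp (x j))) <=
  `|tau i k| * (q - e * (m * q) * capped_field k x).
Proof.
move=> ik; have m0 := m_ge0; have e0 := tilt_ge0 m0.
have t0 := tanhR_ge0 m0; have t1 := tanhR_lt1 m.
rewrite (tau_sym i k); set u := `|tau k i|.
have u0 : 0 <= u by rewrite /u.
pose Y := \sum_(j | j != i) orient k * tau k j * sp (x j).
pose b := `|h k| - Y - u.
pose s := 1 - th m ^+ 2; pose d := 1 - th b * th (b + 2 * u).
pose T := \sum_(j | j != i) `|tau k j|.
have T0 : 0 <= T by exact: sumr_ge0.
have uT : u + T <= m by have := tau_row k; rewrite (bigD1 i).
have YT : `|Y| <= T.
  apply: le_trans (ler_norm_sum _ _ _) _; apply: ler_sum => j _.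
  by rewrite !normrM norm_orient norm_spin mulr1 mul1r.
move: YT; rewrite ler_norml => /andP[YT1 YT2].
have hk := h_large k.
have mb : m <= b by rewrite /b; lra.
have tb : th m <= th b by exact: tanhR_le.
have tbu : th b <= th (b + 2 * u) by apply: tanhR_le; lra.
have bu1 := tanhR_lt1 (b + 2 * u).
have d0 : 0 <= d by rewrite /d; exact: ltW (tanhR_mul_lt1 _ _).
have sd : 0 <= s - d by rewrite /s /d; nra.
have J : `|jump h tau i k x| / 2 <= u * d.
  rewrite norm_jump // -/u -/Y -/b tanhR_sub addrAC subrr add0r mulrC.
  rewrite [th _ * th b]mulrC -/d.
  have u2 : 0 <= 2 * u by lra.
  have := ler_wpM2r d0 (tanhR_le_id u2); lra.
pose c j := (capped_field j (upd x i true) + capped_field j (upd x i false)) / 2.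
have cb j : m <= c j <= 3 * m + 1.
  have /andP[c1 c2] := capped_field_bounds j (upd x i true).
  have /andP[c3 c4] := capped_field_bounds j (upd x i false).
  by rewrite /c; apply/andP; split; lra.
pose C := \sum_(j | j != i) `|tau k j| * c j.
have C1 : C <= m * (3 * m + 1).
  apply: (@le_trans _ _ (\sum_(j | j != i) `|tau k j| * (3 * m + 1))).
    by apply: ler_sum => j _; rewrite ler_wpM2l//; have /andP[] := cb j.
  by rewrite -mulr_suml -/T ler_wpM2r//; lra.
have W : 0 <= (weight k (upd x i true) + weight k (upd x i false)) / 2 <= 1 - e * C.
  have /andP[w1 w2] := weight_bounds k (upd x i true).
  have /andP[w3 w4] := weight_bounds k (upd x i false).
  apply/andP; split; first by lra.
  rewrite /weight.
  have -> : (1 - e * (\sum_j `|tau k j| * capped_field j (upd x i true)) +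
    (1 - e * (\sum_j `|tau k j| * capped_field j (upd x i false)))) / 2 =
    1 - e * (\sum_j `|tau k j| * c j).
    have -> : \sum_j `|tau k j| * c j =
      (\sum_j `|tau k j| * capped_field j (upd x i true) +
       \sum_j `|tau k j| * capped_field j (upd x i false)) / 2.
      by rewrite -big_split mulr_suml; apply: eq_bigr => j _; rewrite /c/=; field.
    by field.
  rewrite lerD2l lerN2 ler_wpM2l// (bigD1 i)//= -/C lerDr mulr_ge0//.
  by have /andP[+ _] := cb i; lra.
have S : \sum_(j | j != i) orient k * tau k j * (mean_mag h tau i j x - sp (x j))
    <= - Y + (T * (th m - s * m) + s * C).
  rewrite /Y /T /C mulr_suml mulr_sumr -sumrN -!big_split/=.
  apply: ler_sum => j _.
  have : orient k * tau k j * mean_mag h tau i j x <=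
      `|tau k j| * (th m + s * (c j - m)).
    apply: (le_trans (ler_norm _)); rewrite normrM (normrM (orient k)) norm_orient mul1r.
    exact: (ler_wpM2l (normr_ge0 _) (norm_mean_mag i j x)).
  lra.
have key : s - 3 / 4 * (s - d) - e * Y + e * (m * (th m - s * m)) <=
    q - e * (m * q) * capped_field k x.
  apply: (@site_inequality _ m b u Y (capped_field k x) s d) => //.
  - by apply/andP; split; lra.
  - by rewrite /b; lra.
  - by lra.
  - have px : push k x = Y + orient k * tau k i * sp (x i).
      rewrite /push mulr_sumr (bigD1 i)//= addrC mulrA; congr (_ + _).
      by apply: eq_bigr => j _; rewrite mulrA.
    have : `|orient k * tau k i * sp (x i)| <= u.
      by rewrite !normrM norm_orient norm_spin mulr1 mul1r.
    rewrite ler_norml => /andP[p1 p2].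
    rewrite /capped_field px.
    have : Num.min `|h k| (2 * m + 1) <= `|h k| by rewrite ge_min lexx.
    by rewrite /b; lra.
  - by have /andP[] := capped_field_bounds k x.
case/andP: W => W0 W1.
have h1 : `|jump h tau i k x| / 2 *
    ((weight k (upd x i true) + weight k (upd x i false)) / 2) <= u * d * (1 - e * C).
  by apply: ler_pM => //; rewrite divr_ge0.
have h2 : e * (\sum_(j | j != i)
    orient k * tau k j * (mean_mag h tau i j x - sp (x j))) <=
    e * (- Y + (T * (th m - s * m) + s * C)) by rewrite ler_wpM2l.
have h3 : T * (th m - s * m) <= m * (th m - s * m).
  rewrite ler_wpM2r//; last lra.
  by rewrite subr_ge0 mulrC; exact: sech2_mul_le_tanhR.
have h4 : e * ((s - d) * C) <= 1 / 4 * (s - d).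
  rewrite mulrCA mulrC ler_wpM2r//.
  by apply: le_trans (tilt_le m0); rewrite ler_wpM2l.
have h5 : d * (1 - e * C) + e * (- Y + (T * (th m - s * m) + s * C)) <=
    q - e * (m * q) * capped_field k x.
  have := ler_wpM2l e0 h3; lra.
have := ler_wpM2l u0 h2; have := ler_wpM2l u0 h5; lra.
Qed.

(** One application of all heat-bath operators contracts weighted gradients.
    The updates of the sites other than [i] leave [N - 1] copies of the weight,
    and exchanging the sums in the drift groups all corrections by neighbour. *)
Lemma grad_sum_heat_bath_le f (K : R) : 0 <= K ->
  (forall i x, `|grad i f x| <= K * weight i x) ->
  forall i x, `|grad i (fun y => \sum_j heat_bath h tau j f y) x| <=
    (N%:R - 1 + m * q) * K * weight i x.
Proof.
move=> K0 fK i x.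
have -> : grad i (fun y => \sum_j heat_bath h tau j f y) x =
    \sum_(j | j != i) grad i (heat_bath h tau j f) x.
  rewrite /grad -sumrB (bigD1 i)//=.
  by have := grad_heat_bath_self h f x (tau_diag i); rewrite /grad => ->; rewrite add0r.
(* The drift of the weight of [i] and the influence of [i], for an update at [j]. *)
pose drift j := \sum_k `|tau i k| * (orient k * tau k j * (mean_mag h tau i j x - sp (x j))).
pose infl j := `|jump h tau i j x| / 2 *
    ((weight j (upd x i true) + weight j (upd x i false)) / 2).
have mag j : -1 <= mean_mag h tau i j x <= 1.
  rewrite /mean_mag.
  have := tanhR_lt1 (lf j (upd x i true)); have := tanhR_lt1 (lf j (upd x i false)).
  have := tanhR_gtN1 (lf j (upd x i true)); have := tanhR_gtN1 (lf j (upd x i false)).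
  by move=> a1 a2 a3 a4; apply/andP; split; lra.
apply: (@le_trans _ _ (\sum_(j | j != i) K * (weight i x + e * drift j + infl j))).
  apply: le_trans (ler_norm_sum _ _ _) _; apply: ler_sum => j ji.
  rewrite grad_heat_bath 1?eq_sym// -weight_mix /infl.
  have /andP[a1 a2] := mag j.
  have KD (A B C : R) : K * (A + B + C) = K * A + K * B + K * C by ring.
  rewrite KD; apply: le_trans (ler_normD _ _) _; apply: lerD.
    apply: le_trans (ler_normD _ _) _; apply: lerD; rewrite normrM mulrCA.
      by rewrite ger0_norm ?ler_wpM2l ?fK//; lra.
    by rewrite ger0_norm ?ler_wpM2l ?fK//; lra.
  rewrite normrM normrM (@ger0_norm _ 2^-1)//; last by lra.
  rewrite mulrCA ler_wpM2l ?divr_ge0// normrM (@ger0_norm _ 2^-1)//; last by lra.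
  rewrite mulrA ler_wpM2r//; first by lra.
  by rewrite mulrDr; apply: le_trans (ler_normD _ _) _; apply: lerD; exact: fK.
rewrite -mulr_sumr [leRHS](_ : _ = K * ((N%:R - 1 + m * q) * weight i x)); last by ring.
rewrite ler_wpM2l// big_split big_split/=.
have -> : \sum_(j < N | j != i) weight i x = (N%:R - 1) * weight i x.
  have : \sum_(j < N) weight i x = N%:R * weight i x.
    by rewrite sumr_const card_ord mulr_natl.
  by rewrite (bigD1 i)//=; lra.
rewrite [leRHS]mulrDl -[leLHS]addrA lerD2l.
have -> : \sum_(j | j != i) e * drift j = \sum_(k | k != i) `|tau i k| *
    (e * \sum_(j | j != i) orient k * tau k j * (mean_mag h tau i j x - sp (x j))).
  rewrite -mulr_sumr /drift exchange_big/= (bigD1 i)//= big1 ?add0r.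
    by rewrite mulr_sumr; apply: eq_bigr => k _; rewrite -mulr_sumr mulrCA.
  by move=> j _; rewrite tau_diag normr0 mul0r.
rewrite -big_split/=.
apply: (@le_trans _ _ (\sum_(k | k != i) `|tau i k| * (q - e * (m * q) * capped_field k x))).
  apply: ler_sum => k ki; rewrite addrC.
  by apply: site_contraction; rewrite eq_sym.
have q0 : 0 <= q by apply: ltW; exact: sech_gt0.
have -> : \sum_(k | k != i) `|tau i k| * (q - e * (m * q) * capped_field k x) =
  q * (\sum_k `|tau i k|) - e * (m * q) * \sum_k `|tau i k| * capped_field k x.
  rewrite !mulr_sumr -sumrB [RHS](bigD1 i)//= tau_diag normr0 !mul0r !mulr0 subrr add0r.
  by apply: eq_bigr => k _; ring.
have := ler_wpM2l q0 (tau_row i); rewrite /weight; lra.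
Qed.

End Bounds.
End Contraction.

(** * From contraction to the Poincare inequality *)

(** For a log-convex sequence the ratios of consecutive terms increase, so the
    first ratio is at most the exponential growth rate. *)
Lemma logconvex_ratio_le (R : realType) (b : nat -> R) (r C : R) :
  0 <= r -> (forall n, 0 <= b n) -> (forall n, b n.+1 ^+ 2 <= b n * b n.+2) ->
  (forall n, b n <= C * r ^+ n) -> b 1%N <= r * b 0%N.
Proof.
move=> r0 b0 bc bC; rewrite leNgt; apply/negP => lt.
have b00 : 0 < b 0%N.
  rewrite lt_neqAle b0 andbT; apply/eqP => b00.
  have := bc 0%N; rewrite -b00 mul0r => b1; move: lt; rewrite -b00 mulr0.
  by have := b0 1%N; nra.
pose c := b 1%N / b 0%N.
have c0 : r < c by rewrite /c ltr_pdivlMr.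
have cp : 0 < c by apply: le_lt_trans c0.
have step n : 0 < b n /\ c * b n <= b n.+1.
  elim: n => [|n [bn cn]]; first by rewrite /c divfK ?gt_eqF.
  have bn1 : 0 < b n.+1 by apply: lt_le_trans cn; rewrite mulr_gt0.
  split => //; rewrite -(ler_pM2l bn); apply: le_trans (bc n).
  by rewrite mulrA [b n * c]mulrC expr2 ler_wpM2r// ltW.
have low n : b 0%N * c ^+ n <= b n.
  elim: n => [|n ih]; first by rewrite expr0 mulr1.
  by apply: le_trans (step n).2; rewrite exprS mulrCA ler_wpM2l// ltW.
have C0 : 0 <= C by have := bC 0%N; rewrite expr0 mulr1; apply: le_trans.
have rp : 0 < r.
  rewrite lt_neqAle r0 andbT; apply/eqP => r00.
  have := bC 1%N; rewrite -r00 expr1 mulr0; have [b1 _] := step 1%N; lra.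
pose d := c / r - 1; have d0 : 0 < d by rewrite /d subr_gt0 ltr_pdivlMr ?mul1r.
have bern n : 1 + n%:R * d <= (c / r) ^+ n.
  elim: n => [|n ih]; first by rewrite mul0r addr0 expr0.
  rewrite exprS (_ : c / r = 1 + d); last by rewrite /d; ring.
  apply: (@le_trans _ _ ((1 + d) * (1 + n%:R * d))).
    rewrite -natr1; have : 0 <= n%:R * d * d by rewrite !mulr_ge0// ltW.
    lra.
  rewrite ler_wpM2l//; first by lra.
  by rewrite (_ : 1 + d = c / r)// /d; ring.
have up n : b 0%N * (1 + n%:R * d) <= C.
  apply: (@le_trans _ _ (b 0%N * (c / r) ^+ n)); first by rewrite ler_wpM2l ?bern// ltW.
  rewrite expr_div_n mulrA ler_pdivrMr ?exprn_gt0//.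
  exact: le_trans (low n) (bC n).
have Cbd : 0 <= C / (b 0%N * d) by rewrite divr_ge0// mulr_ge0// ltW.
have := archi_boundP Cbd; set n := Num.Def.archi_bound _.
rewrite ltr_pdivrMr ?mulr_gt0// => h.
by have := up n; lra.
Qed.

Section Reversible.
Variables (R : realType) (N : nat) (nu : config N -> R).
Implicit Types (x y : config N) (i : 'I_N) (f g : config N -> R).

Definition dot f g : R := \sum_x nu x * (f x * g x).

Definition total_cond_expect f x : R := \sum_(i < N) cond_expect nu i f x.

Lemma agree_off_refl i x : agree_off i x x.
Proof. by apply/forallP => j; rewrite eqxx implybT. Qed.

Lemma agree_off_sym i x y : agree_off i x y = agree_off i y x.
Proof. by apply: eq_forallb => j; rewrite [y j == _]eq_sym. Qed.

Lemma agree_off_eq i x y : agree_off i x y -> agree_off i x =1 agree_off i y.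
Proof.
move=> /forallP xy z; apply: eq_forallb => j.
by have := xy j; case: eqP => //= _ /eqP ->.
Qed.

Lemma cond_expect_class i f x y : agree_off i x y ->
  cond_expect nu i f x = cond_expect nu i f y.
Proof.
by move=> xy; rewrite /cond_expect !(eq_bigl _ _ (agree_off_eq xy)).
Qed.

(** Detailed balance: both sides are sums over pairs in a common class. *)
Lemma dot_cond_expect i f g :
  dot f (cond_expect nu i g) = dot (cond_expect nu i f) g.
Proof.
rewrite /dot /cond_expect.
transitivity (\sum_x \sum_y (if agree_off i x y then
   nu x * nu y * f x * g y / (\sum_(z | agree_off i x z) nu z) else 0)).
  apply: eq_bigr => x _; rewrite -big_mkcond/= mulrA mulr_suml mulr_sumr.
  by apply: eq_bigr => y _; ring.
rewrite exchange_big/=; apply: eq_bigr => x _.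
rewrite -big_mkcond/= [_ * g x]mulrC mulrA mulr_suml mulr_sumr.
rewrite (eq_bigl _ _ (fun y => agree_off_sym i y x)).
apply: eq_bigr => y xy.
by rewrite -(eq_bigl _ _ (agree_off_eq xy)); ring.
Qed.

Section Positive.
Hypotheses (nu_gt0 : forall x, 0 < nu x) (nu_sum : \sum_x nu x = 1).

Lemma class_mass_gt0 i x : 0 < \sum_(y | agree_off i x y) nu y.
Proof.
rewrite (bigD1 x) ?agree_off_refl//= ltr_pwDl//.
by apply: sumr_ge0 => y _; exact: ltW.
Qed.

Lemma cond_expect_idem i f :
  cond_expect nu i (cond_expect nu i f) = cond_expect nu i f.
Proof.
apply/funext => x; rewrite {1}/cond_expect.
rewrite (eq_bigr (fun y => nu y * cond_expect nu i f x)); last first.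
  by move=> y xy; rewrite (cond_expect_class f xy).
by rewrite -mulr_suml mulrAC divff ?mul1r// gt_eqF// class_mass_gt0.
Qed.

Lemma cond_expect_cst i (a : R) : cond_expect nu i (fun=> a) = fun=> a.
Proof.
apply/funext => x; rewrite /cond_expect -mulr_suml mulrAC divff ?mul1r//.
by rewrite gt_eqF// class_mass_gt0.
Qed.

Lemma cond_expectB i f g x :
  cond_expect nu i (fun y => f y - g y) x = cond_expect nu i f x - cond_expect nu i g x.
Proof.
rewrite /cond_expect -mulrBl -sumrB; congr (_ / _).
by apply: eq_bigr => y _; rewrite mulrBr.
Qed.

Lemma dot_ge0 f : 0 <= dot f f.
Proof. by apply: sumr_ge0 => x _; rewrite -expr2 mulr_ge0 ?sqr_ge0// ltW. Qed.

Lemma cauchy_schwarz f g : dot f g ^+ 2 <= dot f f * dot g g.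
Proof.
have [g0|g0] := eqVneq (dot g g) 0.
  suff -> : dot f g = 0 by rewrite g0 mulr0 expr0n.
  have {}g0 x : g x = 0.
    have /eqP := g0; rewrite psumr_eq0; last first.
      by move=> y _; rewrite -expr2 mulr_ge0 ?sqr_ge0// ltW.
    move=> /allP/(_ x); rewrite mem_index_enum => /(_ isT)/=.
    by rewrite mulf_eq0 gt_eqF//= -expr2 sqrf_eq0 => /eqP.
  by rewrite /dot big1// => x _; rewrite g0 !mulr0.
have gp : 0 < dot g g by rewrite lt_neqAle eq_sym g0 dot_ge0.
have E (a c : R) : dot (fun x => a * f x - c * g x) (fun x => a * f x - c * g x) =
    a ^+ 2 * dot f f - 2 * a * c * dot f g + c ^+ 2 * dot g g.
  rewrite /dot !mulr_sumr -sumrB -big_split/=.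
  by apply: eq_bigr => x _; ring.
have := dot_ge0 (fun x => dot g g * f x - dot f g * g x).
rewrite E (_ : _ + _ = dot g g * (dot f f * dot g g - dot f g ^+ 2)); last by ring.
by rewrite pmulr_rge0// subr_ge0.
Qed.

Lemma dirichletE f :
  glauber_dirichlet nu f = N%:R * dot f f - dot f (total_cond_expect f).
Proof.
have E i : \sum_x nu x * (cond_expect nu i f x - f x) ^+ 2 =
    dot f f - dot f (cond_expect nu i f).
  transitivity (dot (cond_expect nu i f) (cond_expect nu i f) -
     2 * dot f (cond_expect nu i f) + dot f f).
    rewrite /dot mulr_sumr -sumrB -big_split/=.
    by apply: eq_bigr => x _; ring.
  by rewrite -dot_cond_expect cond_expect_idem; ring.
rewrite /glauber_dirichlet /expect.
under eq_bigr do rewrite mulr_sumr.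
rewrite exchange_big/= (eq_bigr _ (fun i _ => E i)) sumrB sumr_const card_ord.
rewrite mulr_natl; congr (_ - _); rewrite /dot exchange_big/=.
by apply: eq_bigr => x _; rewrite /total_cond_expect !mulr_sumr.
Qed.

Lemma dot_total_cond_expect f g :
  dot f (total_cond_expect g) = dot (total_cond_expect f) g.
Proof.
transitivity (\sum_(i < N) dot f (cond_expect nu i g)).
  rewrite /dot exchange_big/=; apply: eq_bigr => x _.
  by rewrite /total_cond_expect !mulr_sumr.
under eq_bigr do rewrite dot_cond_expect.
rewrite /dot exchange_big/=; apply: eq_bigr => x _.
by rewrite /total_cond_expect mulr_suml mulr_sumr.
Qed.

Lemma total_cond_expect_cst (a : R) :
  total_cond_expect (fun=> a) = fun=> N%:R * a.
Proof.
apply/funext => x; rewrite /total_cond_expect.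
under eq_bigr do rewrite cond_expect_cst.
by rewrite sumr_const card_ord mulr_natl.
Qed.

Lemma total_cond_expectB f g : total_cond_expect (fun y => f y - g y) =
  fun y => total_cond_expect f y - total_cond_expect g y.
Proof.
apply/funext => x; rewrite /total_cond_expect -sumrB.
by apply: eq_bigr => i _; rewrite cond_expectB.
Qed.

Definition osc_le f (B : R) := forall x y, `|f x - f y| <= B.

(** A centred function is pointwise bounded by its oscillation. *)
Lemma centered_dot_le f B : 0 <= B -> dot (fun=> 1) f = 0 -> osc_le f B ->
  dot f f <= B ^+ 2.
Proof.
move=> B0 f0 fB.
have bf x : `|f x| <= B.
  have -> : f x = \sum_y nu y * (f x - f y).
    under eq_bigr do rewrite mulrBr.
    rewrite sumrB -mulr_suml nu_sum mul1r.
    suff -> : \sum_y nu y * f y = 0 by rewrite subr0.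
    by apply: etrans f0; apply: eq_bigr => y _; rewrite mul1r.
  apply: le_trans (ler_norm_sum _ _ _) _.
  apply: (@le_trans _ _ (\sum_y nu y * B)); last by rewrite -mulr_suml nu_sum mul1r.
  apply: ler_sum => y _; rewrite normrM ger0_norm ?ler_wpM2l ?fB// ltW//.
rewrite -[leRHS]mul1r -nu_sum mulr_suml; apply: ler_sum => x _.
rewrite ler_wpM2l ?(ltW (nu_gt0 x))// -expr2 -real_normK ?num_real//.
by rewrite lerXn2r// nnegrE.
Qed.

(** Self-adjointness makes the squared norms of the iterates of the centred
    function log-convex, so any exponential bound on the oscillations, with
    whatever constant [C], becomes the operator norm bound [r] in [L^2]. *)
Lemma poincare_of_oscillation f (r C : R) : 0 <= r -> 0 <= C ->
  (forall n, osc_le (iter n total_cond_expect f) (C * r ^+ n)) ->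
  (N%:R - r) * variance nu f <= glauber_dirichlet nu f.
Proof.
move=> r0 C0 osc.
pose a := expect nu f; pose f0 := fun x => f x - a.
have iterE n : iter n total_cond_expect f0 =
    fun x => iter n total_cond_expect f x - N%:R ^+ n * a.
  elim: n => [|n ih]; first by apply/funext => x; rewrite /= expr0 mul1r.
  by rewrite !iterS ih total_cond_expectB total_cond_expect_cst exprS mulrA.
have mean0 n : dot (fun=> 1) (iter n total_cond_expect f0) = 0.
  elim: n => [|n ih] /=.
    rewrite /dot /f0; under eq_bigr do rewrite mul1r mulrBr.
    by rewrite sumrB -mulr_suml nu_sum mul1r subrr.
  rewrite dot_total_cond_expect total_cond_expect_cst -[RHS](mulr0 N%:R) -ih.
  by rewrite /dot mulr_sumr; apply: eq_bigr => x _; ring.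
pose b n := dot (iter n total_cond_expect f0) (iter n total_cond_expect f0).
have h1 : b 1%N <= r ^+ 2 * b 0%N.
  apply: (@logconvex_ratio_le _ b _ (C ^+ 2)).
  - exact: sqr_ge0.
  - by move=> n; exact: dot_ge0.
  - move=> n; rewrite /b [iter n.+2 _ _]iterS iterS.
    rewrite -[X in X ^+ 2]dot_total_cond_expect.
    exact: cauchy_schwarz.
  - move=> n; rewrite -exprM mulnC exprM -exprMn; apply: centered_dot_le => //.
      by rewrite mulr_ge0// exprn_ge0.
    by move=> x y; rewrite iterE opprB addrA subrK; exact: osc.
have h2 : dot f0 (total_cond_expect f0) <= r * dot f0 f0.
  have : dot f0 (total_cond_expect f0) ^+ 2 <= (r * dot f0 f0) ^+ 2.
    apply: le_trans (cauchy_schwarz _ _) _.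
    rewrite exprMn expr2 [dot f0 f0 ^+ 2]expr2 mulrCA.
    by rewrite ler_wpM2l ?dot_ge0.
  case: (lerP 0 (dot f0 (total_cond_expect f0))) => h.
    by rewrite ler_pXn2r ?nnegrE ?mulr_ge0 ?dot_ge0.
  by move=> _; apply: le_trans (ltW h) _; rewrite mulr_ge0 ?dot_ge0.
have -> : variance nu f = dot f0 f0.
  by rewrite /variance {1}/expect /dot; apply: eq_bigr => x _; rewrite expr2.
have -> : glauber_dirichlet nu f = glauber_dirichlet nu f0.
  rewrite /glauber_dirichlet; apply: eq_bigr => x _; congr (_ * _).
  by apply: eq_bigr => i _; rewrite /f0 cond_expectB cond_expect_cst; congr (_ ^+ 2); ring.
by rewrite dirichletE mulrBl lerD2l lerN2.
Qed.

End Positive.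
End Reversible.

(** Two configurations are joined by changing one coordinate at a time. *)
Lemma osc_le_grad (R : realType) (N : nat) (g : config N -> R) (B : R) :
  (forall i x, `|grad i g x| <= B) -> osc_le g (N%:R * B).
Proof.
move=> gB x y.
pose z n : config N := [ffun k : 'I_N => if (k < n)%N then y k else x k].
have zN : z N = y by apply/ffunP => k; rewrite ffunE ltn_ord.
have z0 : z 0%N = x by apply/ffunP => k; rewrite ffunE.
have step u i b : `|g u - g (upd u i b)| <= B.
  apply: le_trans (gB i u); rewrite /grad -{1}(upd_id u i).
  by case: (u i); case: b; rewrite ?subrr ?normr0// distrC.
have H n : (n <= N)%N -> `|g x - g (z n)| <= n%:R * B.
  elim: n => [_|n ih nN]; first by rewrite z0 subrr normr0 mul0r.
  have -> : z n.+1 = upd (z n) (Ordinal nN) (y (Ordinal nN)).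
    apply/ffunP => k; rewrite updE !ffunE ltnS leq_eqVlt -val_eqE /=.
    by case: eqP => //= kn; rewrite (_ : k = Ordinal nN)//; apply: val_inj.
  have := ler_distD (g (z n)) (g x) (g (upd (z n) (Ordinal nN) (y (Ordinal nN)))).
  have := ih (ltnW nN); have := step (z n) (Ordinal nN) (y (Ordinal nN)).
  by rewrite -natr1; lra.
by have := H N (leqnn N); rewrite zN.
Qed.

(** * Gibbs measures *)

Section Gibbs.
Variables (R : realType) (N : nat) (beta : R) (W : 'M[R]_N) (h : 'cV[R]_N).
Implicit Types (x : config N) (i j k : 'I_N) (f : config N -> R).
Local Notation sp := (spin R).
Local Notation th := (@tanhR R).
Local Notation nu := (gibbs beta W h).

Definition coupling j k : R := if j == k then 0 else beta * W j k.

Local Notation lf := (local_field (fun j => h j 0) coupling).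

Lemma coupling_diag i : coupling i i = 0.
Proof. by rewrite /coupling eqxx. Qed.

Lemma coupling_sym i j : W^T = W -> coupling i j = coupling j i.
Proof. by move=> Wsym; rewrite /coupling eq_sym -{1}Wsym mxE. Qed.

Lemma gibbs_weight_gt0 x : 0 < gibbs_weight beta W h x.
Proof. exact: expR_gt0. Qed.

Lemma partition_function_gt0 : 0 < partition_function beta W h.
Proof.
rewrite /partition_function (bigD1 [ffun=> true])//=.
rewrite ltr_pwDl ?gibbs_weight_gt0// sumr_ge0// => x _.
exact: ltW (gibbs_weight_gt0 x).
Qed.

Lemma gibbs_gt0 x : 0 < nu x.
Proof. by rewrite divr_gt0 ?gibbs_weight_gt0 ?partition_function_gt0. Qed.

Lemma gibbs_sum : \sum_x nu x = 1.
Proof. by rewrite -mulr_suml divff// gt_eqF// partition_function_gt0. Qed.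

Lemma sum_agree_off i x (F : config N -> R) :
  \sum_(y | agree_off i x y) F y = F (upd x i true) + F (upd x i false).
Proof.
have neq : upd x i true != upd x i false.
  by apply/eqP => /ffunP/(_ i); rewrite !updE eqxx.
have ag b : agree_off i x (upd x i b).
  by apply/forallP => j; apply/implyP => ji; rewrite updE (negbTE ji).
rewrite (bigD1 (upd x i true)) ?ag//= (bigD1 (upd x i false)) ?ag 1?eq_sym//=.
rewrite big1 ?addr0// => y /andP[/andP[/forallP xy yt] yf].
suff E : y = upd x i (y i).
  by move: yt yf; rewrite E; case: (y i); rewrite eqxx.
apply/ffunP => j; rewrite updE; case: eqP => [->//|/eqP ji].
by have := xy j; rewrite ji => /eqP.
Qed.

(** The diagonal of [W] contributes a constant to the energy, since spins square
    to 1, which is why [coupling] vanishes on the diagonal. *)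
Lemma gibbs_weight_ratio j x : W^T = W ->
  gibbs_weight beta W h (upd x j true) =
  gibbs_weight beta W h (upd x j false) * expR (2 * lf j x).
Proof.
move=> Wsym; rewrite /gibbs_weight -expRD; congr expR.
have Wjk i k : W i k = W k i by rewrite -{1}Wsym mxE.
pose Q y := \sum_i (\sum_k W i k * sp (y k)) * sp (y i).
pose L y := \sum_i h i 0 * sp (y i).
have QE y : inner (spin_vec R y) (W *m spin_vec R y) = Q y.
  apply: eq_bigr => i _; rewrite !mxE mulrC; congr (_ * _).
  by apply: eq_bigr => k _; rewrite mxE.
have LE y : inner (spin_vec R y) h = L y.
  by apply: eq_bigr => i _; rewrite mxE mulrC.
rewrite !QE !LE; set z := upd x j false.
have -> : upd x j true = upd z j true by rewrite upd_upd.
have -> : lf j x = lf j z by rewrite local_field_upd_self// coupling_diag.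
have zj : sp (z j) = -1 by rewrite updE eqxx.
have LU : L (upd z j true) = L z + 2 * h j 0.
  by rewrite /L sum_upd zj /spin; ring.
have QU : Q (upd z j true) = Q z + 4 * (\sum_k W j k * sp (z k)) + 4 * W j j.
  rewrite /Q sum_upd zj.
  have rowE i : \sum_k W i k * sp (upd z j true k) =
      \sum_k W i k * sp (z k) + 2 * W i j by rewrite sum_upd zj /spin; ring.
  under eq_bigr do rewrite rowE mulrDl.
  rewrite big_split/= rowE.
  have -> : \sum_i 2 * W i j * sp (z i) = 2 * \sum_k W j k * sp (z k).
    by rewrite mulr_sumr; apply: eq_bigr => i _; rewrite Wjk; ring.
  by rewrite /spin; ring.
have lfE : lf j z = h j 0 - beta * (\sum_k W j k * sp (z k) + W j j).
  rewrite /local_field [in RHS](bigD1 j)//= zj (bigD1 j)//= coupling_diag.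
  have -> : \sum_(k < N | k != j) coupling j k * sp (z k) =
      beta * \sum_(k < N | k != j) W j k * sp (z k).
    rewrite mulr_sumr; apply: eq_bigr => k kj.
    by rewrite /coupling eq_sym (negbTE kj) mulrA.
  by ring.
by rewrite QU LU lfE; field.
Qed.

Lemma cond_expect_gibbs j f : W^T = W ->
  cond_expect nu j f = heat_bath (fun i => h i 0) coupling j f.
Proof.
move=> Wsym; apply/funext => x.
rewrite /cond_expect !sum_agree_off /heat_bath /gibbs gibbs_weight_ratio//.
have w0 := gibbs_weight_gt0 (upd x j false); set w := gibbs_weight _ _ _ _ in w0 *.
have Z0 := partition_function_gt0; set Z := partition_function _ _ _ in Z0 *.
rewrite /tanhR; have E0 := expR_gt0 (2 * lf j x); set E := expR _ in E0 *.
have wE : 0 < w * E by rewrite mulr_gt0.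
by field; rewrite !gt_eqF//; lra.
Qed.

End Gibbs.

Unset Implicit Arguments.

Theorem theorem4p3 (R : realType) (N : nat) (beta : R) (W : 'M[R]_N)
    (h : 'cV[R]_N)
    (hN : (1 <= N)%N) (hbeta : 0 < beta) (hW : W^T = W)
    (hfield : min_abs h >=
       2 * beta * sup (range (fun i : 'I_N => \sum_(k < N | k != i) `|W i k|)))
    (f : {ffun 'I_N -> bool} -> R) :
  variance (gibbs beta W h) f <=
    1 / (1 - min_abs h /
             (expR (3 * min_abs h / 4) + expR (- (3 * min_abs h / 4))))
    * glauber_dirichlet (gibbs beta W h) f.
Proof.
pose m := min_abs h / 2.
pose hv (i : 'I_N) := h i 0; pose tau := coupling beta W.
pose q := sech (3 * m / 2).
have m0 : 0 <= m.
  rewrite /m divr_ge0// /min_abs; apply: lb_le_inf.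
    by exists `|h (Ordinal hN) 0|; exists (Ordinal hN).
  by move=> _ [i _ <-].
have h_large i : 2 * m <= `|hv i|.
  rewrite /m mulrC divfK ?pnatr_eq0//; apply: ge_inf; last by exists i.
  by exists 0 => _ [j _ <-].
have tau_row i : \sum_k `|tau i k| <= m.
  have -> : \sum_k `|tau i k| = beta * \sum_(k < N | k != i) `|W i k|.
    rewrite (bigD1 i)//= /tau coupling_diag normr0 add0r mulr_sumr.
    apply: eq_bigr => k ki; rewrite /coupling eq_sym (negbTE ki) normrM.
    by rewrite gtr0_norm.
  suff : beta * \sum_(k < N | k != i) `|W i k| <=
      beta * sup (range (fun i : 'I_N => \sum_(k < N | k != i) `|W i k|)).
    by rewrite /m; move: hfield; lra.
  rewrite ler_pM2l//; apply: ub_le_sup; last by exists i.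
  exists (\sum_(j < N) \sum_(k < N | k != j) `|W j k|) => _ [j _ <-].
  rewrite [leRHS](bigD1 j)//= lerDl; apply: sumr_ge0 => l _.
  exact: sumr_ge0.
have tau_sym i j : tau i j = tau j i by exact: coupling_sym.
have tau_diag i : tau i i = 0 by exact: coupling_diag.
have q0 : 0 < q by exact: sech_gt0.
have mq := mul_sech_le_half m0; rewrite -/q in mq.
have -> : min_abs h / (expR (3 * min_abs h / 4) + expR (- (3 * min_abs h / 4)))
    = m * q.
  rewrite /q /sech (_ : 3 * m / 2 = 3 * min_abs h / 4) /m; last by field.
  set u := 3 * min_abs h / 4.
  have u0 : 0 < expR u + expR (- u) by rewrite addr_gt0// expR_gt0.
  by field; rewrite gt_eqF.
pose r := N%:R - 1 + m * q.
have N1 : 1 <= N%:R :> R by rewrite ler1n.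
have mq0 : 0 <= m * q by rewrite mulr_ge0// ltW.
have r0 : 0 <= r by rewrite /r; lra.
(* Weights are at least 3/4, whence the constant. *)
pose S := \sum_i \sum_x `|grad i f x|; pose K := 4 / 3 * S.
have S0 : 0 <= S.
  by apply: sumr_ge0 => i _; apply: sumr_ge0 => x _.
have K0 : 0 <= K by rewrite /K; lra.
have wb i x := andP (weight_bounds m0 tau_row h_large i x).
have fK i x : `|grad i f x| <= K * weight hv tau m i x.
  have : `|grad i f x| <= S.
    rewrite /S (bigD1 i)//= (bigD1 x)//= -addrA lerDl addr_ge0//.
      exact: sumr_ge0.
    by apply: sumr_ge0 => j _; exact: sumr_ge0.
  have [w1 _] := wb i x; have := ler_wpM2l K0 w1; rewrite /K; lra.
have totalE g : total_cond_expect (gibbs beta W h) g =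
    fun y => \sum_j heat_bath hv tau j g y.
  by apply/funext => x; apply: eq_bigr => j _; rewrite cond_expect_gibbs.
have iterK n i x :
    `|grad i (iter n (total_cond_expect (gibbs beta W h)) f) x| <=
    r ^+ n * K * weight hv tau m i x.
  elim: n i x => [|n ih] i x; first by rewrite expr0 mul1r.
  rewrite iterS totalE exprS -[r * r ^+ n * K]mulrA.
  apply: grad_sum_heat_bath_le => //.
  by rewrite mulr_ge0// exprn_ge0.
have poincare : (N%:R - r) * variance (gibbs beta W h) f <=
    glauber_dirichlet (gibbs beta W h) f.
  apply: (@poincare_of_oscillation _ _ _ _ _ _ _ (N%:R * K)) => //.
  - by move=> x; exact: gibbs_gt0.
  - exact: gibbs_sum.
  - by rewrite mulr_ge0.
  - move=> n; rewrite -mulrA [K * _]mulrC; apply: osc_le_grad => i x.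
    apply: le_trans (iterK n i x) _; rewrite -[leRHS]mulr1 ler_wpM2l//.
      by rewrite mulr_ge0// exprn_ge0.
    by have [] := wb i x.
rewrite mul1r mulrC ler_pdivlMr; last by lra.
by move: poincare; rewrite /r; lra.
Qed.
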